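(* Let $F$ be a field, let $G$ be a finitely presented group and let $V\subseteq G$ be a finite subset (possibly empty). Then for some $n\in\mathbb N$, depending only on the presentation of $G$ and the elements of $V$, there exists an elementary $G$-grading $\Gamma$ on $M_n(F)$ such that the universal group $G_\Gamma$ of $\Gamma$ is isomorphic to $G$ and $V\subseteq\operatorname{supp}\Gamma$.
   Context: The elementary $G$-grading on $M_n(F)$ defined by an $n$-tuple $(g_1,\dots,g_n)$ of elements of $G$ is the grading $M_n(F)=\bigoplus_{g\in G}M_n(F)^{(g)}$ in which each matrix unit $e_{ij}$ is homogeneous of degree $g_ig_j^{-1}$. For a group grading $\Gamma\colon A=\bigoplus_{g\in G}A^{(g)}$, $\operatorname{supp}\Gamma=\lbrace g\in G\mid A^{(g)}\neq0\rbrace$. A realization of $\Gamma$ as a grading by a group $H$ is an $H$-grading of $A$ with the same set of nonzero components; it is recorded by the injection $\psi\colon\operatorname{supp}\Gamma\to H$ sending $g$ to the $H$-degree of $A^{(g)}$. The universal group of $\Gamma$ is a pair $(G_\Gamma,\varkappa_\Gamma)$, where $\Gamma$ is realized as a $G_\Gamma$-grading with support embedding $\varkappa_\Gamma\colon\operatorname{supp}\Gamma\hookrightarrow G_\Gamma$, such that for any realization of $\Gamma$ as a grading by a group $H$ with $\psi\colon\operatorname{supp}\Gamma\hookrightarrow H$ there is a unique homomorphism $\varphi\colon G_\Gamma\to H$ with $\varphi\varkappa_\Gamma=\psi$. Concretely, $G_\Gamma$ is the group generated by symbols $[g]$, $g\in\operatorname{supp}\Gamma$, with relations $[g][h]=[gh]$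 for all $g,h\in\operatorname{supp}\Gamma$ with $A^{(g)}A^{(h)}\neq0$, and $\varkappa_\Gamma(g)$ is the image of $[g]$. *)

(* Defs.v *)
From HB Require Import structures.
From mathcomp Require Import all_boot all_order all_fingroup all_algebra.
From mathcomp Require Import all_classical.

Set Implicit Arguments.
Unset Strict Implicit.
Unset Printing Implicit Defensive.

Local Open Scope classical_set_scope.
Local Open Scope ring_scope.

(* The letter (i, true) stands for the i-th generator, (i, false) for its
   inverse. *)
Definition word (k : nat) := seq ('I_k * bool).

Definition eval_word (G : groupType) (k : nat) (x : 'I_k -> G) (w : word k) : G :=
  (\prod_(l <- w) if l.2 then x l.1 else (x l.1)^-1)%g.

(* Equality in the group <X | R>, X being the set of the k generators: the
   quotient of the monoid of words by this congruence is the quotient of the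
   free group on X by the normal closure of R. *)
Inductive presented_eq (k : nat) (R : seq (word k)) : word k -> word k -> Prop :=
| PresRefl u : presented_eq R u u
| PresSym u v : presented_eq R u v -> presented_eq R v u
| PresTrans u v w :
    presented_eq R u v -> presented_eq R v w -> presented_eq R u w
| PresCat u u' v v' :
    presented_eq R u u' -> presented_eq R v v' ->
    presented_eq R (u ++ v) (u' ++ v')
| PresCancel i b : presented_eq R [:: (i, b); (i, ~~ b)] [::]
| PresRel r : r \in R -> presented_eq R r [::].

(* The generators x and relators R form a finite presentation of G: evaluation
   at x induces an isomorphism from <X | R> onto G. *)
Definition finite_presentation (G : groupType) (k : nat) (x : 'I_k -> G)
    (R : seq (word k)) : Prop :=
  (forall g : G, exists w : word k, eval_word x w = g) /\
  (forall u v : word k, eval_word x u = eval_word x v <-> presented_eq R u v).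

Definition isomorphic_groups (G H : groupType) : Prop :=
  exists f : {multiplicative G -> H}, bijective f.

Record grading (F : fieldType) (A : algType F) (G : groupType) := Grading {
  component :> G -> set A ;
  _ : forall g, GRing.submod_closed (mem (component g)) ;
  (* A is the internal direct sum of the components *)
  _ : forall a : A, exists! c : G -> A,
        [/\ finite_set [set g | c g != 0],
            forall g, component g (c g) &
            a = \sum_(g \in [set: G]) c g] ;
  _ : forall g h a b,
        component g a -> component h b -> component (g * h)%g (a * b)
}.

Definition supp (F : fieldType) (A : algType F) (G : groupType)
    (Gam : grading A G) : set G :=
  [set g | exists2 a, Gam g a & a != 0].

(* Support embeddings are represented by total functions; only their values on
   the support are meaningful. *)
Definition realization (F : fieldType) (A : algType F) (G H : groupType)
    (Gam : grading A G) (Del : grading A H) (psi : G -> H) : Prop :=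
  [/\ set_inj (supp Gam) psi,
      psi @` supp Gam = supp Del &
      forall g, supp Gam g -> Del (psi g) = Gam g].

Definition universal_group (F : fieldType) (A : algType F) (G : groupType)
    (Gam : grading A G) (U : groupType) (kappa : G -> U) : Prop :=
  (exists Del : grading A U, realization Gam Del kappa) /\
  (forall (H : groupType) (Del : grading A H) (psi : G -> H),
     realization Gam Del psi ->
     exists! phi : U -> H,
       {morph phi : u v / (u * v)%g >-> (u * v)%g} /\
       (forall g, supp Gam g -> phi (kappa g) = psi g)).

Definition elementary (F : fieldType) (G : groupType) (n : nat)
    (t : 'I_n.+1 -> G) (Gam : grading 'M[F]_n.+1 G) : Prop :=
  forall i j, Gam (t i * (t j)^-1)%g (delta_mx i j).

(* Main.v *)
Require Import Defs.
From HB Require Import structures.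
From mathcomp Require Import all_boot all_order all_fingroup all_algebra.
From mathcomp Require Import all_classical.

Local Open Scope classical_set_scope.

(** The universal group can be taken to be [G] itself, provided that the tuple
    defining the grading contains enough elements of [G].  Let [P] be a finite
    set of words, closed under taking prefixes, which contains all one-letter
    words, all relators, and a word for each element of [V]; let the tuple list
    the values in [G] of the words in [P].  The support of the elementary
    grading is then the set of quotients a b^-1 of values of words in [P];
    taking b to be the value of the empty word shows that it contains the
    generators and [V].

    A realization [psi] of the grading by a group [H] is multiplicative on
    degrees of components whose product is nonzero ([realization_mul]), because
    a nonzero element has at most one degree.  For matrix units,
    e_ij e_jl = e_il turns this into
    [psi (a b^-1) * psi (b c^-1) = psi (a c^-1)] for all values a, b, c of words
    in [P].  If w and wl are in [P], where l is a letter, then a = wl, b = l,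
    c = 1 give psi (wl) = psi (w) psi (l); likewise [psi] respects inverses of
    generators.  So [psi] sends the value of each word
    in [P] to the product of the images of its letters; as the relators are in
    [P], the images of the generators satisfy them, and they extend to a
    homomorphism from [G] to [H] which agrees with [psi] on the support
    ([quotients_extend_morph]).  It is unique because the support contains the
    generators. *)

(** * Words and homomorphisms out of a presented group *)

Section Words.
Set Implicit Arguments.
Unset Strict Implicit.
Local Open Scope group_scope.

Lemma eval_word_cat (G : groupType) (k : nat) (x : 'I_k -> G) (u v : word k) :
  eval_word x (u ++ v) = eval_word x u * eval_word x v.
Proof. by rewrite /eval_word big_cat. Qed.

Lemma eval_word1 (G : groupType) (k : nat) (x : 'I_k -> G) (l : 'I_k * bool) :
  eval_word x [:: l] = if l.2 then x l.1 else (x l.1)^-1.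
Proof. by rewrite /eval_word big_seq1. Qed.

Lemma eval_word_nil (G : groupType) (k : nat) (x : 'I_k -> G) :
  eval_word x [::] = 1.
Proof. by rewrite /eval_word big_nil. Qed.

Lemma eval_word_morph (G H : groupType) (k : nat) (x : 'I_k -> G) (f : G -> H)
    (w : word k) :
  {morph f : u v / u * v} -> f (eval_word x w) = eval_word (f \o x) w.
Proof.
move=> fM.
have f1 : f 1 = 1 by apply: (mulgI (f 1)); rewrite -fM !mulg1.
have fV a : f a^-1 = (f a)^-1.
  by apply: (mulgI (f a)); rewrite -fM !mulgV.
elim: w => [|l w IHw]; first by rewrite !eval_word_nil.
rewrite -cat1s !eval_word_cat fM IHw !eval_word1 /=.
by case: l.2; rewrite ?fV.
Qed.

Lemma presented_eq_eval (H : groupType) (k : nat) (R : seq (word k))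
    (y : 'I_k -> H) (u v : word k) :
  (forall r, r \in R -> eval_word y r = 1) ->
  presented_eq R u v -> eval_word y u = eval_word y v.
Proof.
move=> yR; elim=> //.
- by move=> ? ? ? _ -> _ ->.
- by move=> ? ? ? ? _ eu _ ev; rewrite !eval_word_cat eu ev.
- move=> i b; rewrite -[[:: _; _]]/([:: _] ++ [:: _]) eval_word_cat.
  by rewrite !eval_word1 eval_word_nil; case: b; rewrite /= ?mulgV ?mulVg.
- by move=> r /yR ->; rewrite eval_word_nil.
Qed.

(** Any choice of a word for each element of [G] defines the homomorphism: two
    words for the same element are congruent modulo the relators, so [y] gives
    them the same value. *)
Lemma von_dyck (G H : groupType) (k : nat) (x : 'I_k -> G) (R : seq (word k))
    (y : 'I_k -> H) :
  finite_presentation x R -> (forall r, r \in R -> eval_word y r = 1) ->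
  exists2 phi : G -> H, {morph phi : u v / u * v} &
    forall w, phi (eval_word x w) = eval_word y w.
Proof.
move=> [gen rel] yR; have [c cK] := boolp.choice gen.
have phiE w : eval_word y (c (eval_word x w)) = eval_word y w.
  by apply: presented_eq_eval yR _; apply/rel; rewrite cK.
exists (fun g => eval_word y (c g)) => // u v.
by rewrite -{1}(cK u) -{1}(cK v) -eval_word_cat phiE eval_word_cat.
Qed.

Lemma morph_generators_eq (G H : groupType) (k : nat) (x : 'I_k -> G)
    (R : seq (word k)) (f f' : G -> H) :
  finite_presentation x R -> {morph f : u v / u * v} ->
  {morph f' : u v / u * v} -> f \o x =1 f' \o x -> f =1 f'.
Proof.
move=> [gen _] fM f'M /funext ff' g; have [w <-] := gen g.
by rewrite !eval_word_morph // ff'.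
Qed.

(** The hypothesis on [psi] is what e_ij e_jl = e_il says of a relabelling of
    the degrees of matrix units.  Taking [v] to be a letter and [w] empty makes
    [psi] multiplicative along each one-letter extension of a word of [P]; hence
    closure under prefixes lets [psi] be computed letter by letter on the value
    of every word of [P].  In particular the relators, being in [P], are killed
    by the images of the generators. *)
Lemma quotients_extend_morph (G H : groupType) (k : nat) (x : 'I_k -> G)
    (R P : seq (word k)) (psi : G -> H) :
  finite_presentation x R ->
  (forall u l, rcons u l \in P -> u \in P) ->
  (forall l, [:: l] \in P) -> [::] \in P -> {subset R <= P} ->
  (forall u v w, u \in P -> v \in P -> w \in P ->
     psi (eval_word x u * (eval_word x v)^-1)
       * psi (eval_word x v * (eval_word x w)^-1)
     = psi (eval_word x u * (eval_word x w)^-1)) ->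
  exists2 phi : G -> H, {morph phi : u v / u * v} &
    forall u v, u \in P -> v \in P ->
      phi (eval_word x u * (eval_word x v)^-1)
      = psi (eval_word x u * (eval_word x v)^-1).
Proof.
move=> pres pfx letP nilP RP tri.
have psi1 : psi 1 = 1.
  have := tri _ _ _ nilP nilP nilP; rewrite eval_word_nil mulgV => psi11.
  by apply: (mulgI (psi 1)); rewrite psi11 mulg1.
have psiV u : u \in P -> psi (eval_word x u)^-1 = (psi (eval_word x u))^-1.
  move=> uP; apply: (mulgI (psi (eval_word x u))); rewrite mulgV.
  by have := tri _ _ _ uP nilP uP; rewrite eval_word_nil invg1 mulg1 mul1g
    mulgV psi1.
pose y := psi \o x.
have psi_let l : psi (eval_word x [:: l]) = eval_word y [:: l].
  case: l => i b; rewrite !eval_word1 /=; case: b => //.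
  by have := psiV [:: (i, true)] (letP _); rewrite eval_word1.
have psi_eval w : w \in P -> psi (eval_word x w) = eval_word y w.
  elim/last_ind: w => [|w l IHw] wlP; first by rewrite !eval_word_nil.
  (* psi ((wl) l^-1) * psi (l 1^-1) = psi ((wl) 1^-1) *)
  have := tri _ _ _ wlP (letP l) nilP.
  rewrite -cats1 !eval_word_cat mulgK eval_word_nil invg1 !mulg1 => <-.
  by rewrite IHw ?psi_let //; apply: pfx wlP.
have yR r : r \in R -> eval_word y r = 1.
  move=> rR; rewrite -psi_eval ?RP //.
  have -> : eval_word x r = eval_word x [::] by apply/(pres.2); apply: PresRel.
  by rewrite eval_word_nil.
have [phi phiM phiE] := von_dyck pres yR.
have phiV a : phi a^-1 = (phi a)^-1.
  apply: (mulgI (phi a)); rewrite -phiM !mulgV.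
  by have := phiE [::]; rewrite !eval_word_nil.
exists phi => // u v uP vP.
(* The quotient a b^-1 is split as (a 1^-1) (1 b^-1). *)
have := tri _ _ _ uP nilP vP.
rewrite eval_word_nil invg1 mulg1 mul1g => <-.
by rewrite phiM phiV !phiE psiV // !psi_eval.
Qed.

Lemma prefix_closed_superset (k : nat) (W : seq (word k)) :
  exists P : seq (word k),
    [/\ [::] \in P, {subset W <= P} &
        forall u l, rcons u l \in P -> u \in P].
Proof.
pose P := [::] :: [seq take m w | w <- W, m <- iota 0 (size w).+1].
exists P; split; first by rewrite mem_head.
- move=> w wW; rewrite inE; apply/orP; right; apply/allpairsPdep.
  by exists w, (size w); rewrite wW mem_iota ltnS leqnn take_size.
- move=> u l; rewrite inE => /orP[|/allpairsPdep[w [m [wW _ ul]]]].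
    by rewrite -size_eq0 size_rcons.
  have upw : prefix u w.
    by apply: prefix_trans (prefix_rcons u l) _; rewrite ul prefix_take.
  rewrite inE; apply/orP; right; apply/allpairsPdep.
  exists w, (size u); split=> //; last by move: upw; rewrite prefixE => /eqP.
  by rewrite mem_iota ltnS size_prefix.
Qed.

End Words.

(** * Gradings and their realizations *)

Section Gradings.
Set Implicit Arguments.
Unset Strict Implicit.
Import GRing.Theory.
Local Open Scope ring_scope.

Lemma grading0 (F : fieldType) (A : algType F) (G : groupType)
    (Gam : grading A G) (g : G) : Gam g 0.
Proof. by case: Gam => c cS ? ? /=; have [/set_mem] := cS g. Qed.

Lemma grading_mul (F : fieldType) (A : algType F) (G : groupType)
    (Gam : grading A G) (g h : G) (a b : A) :
  Gam g a -> Gam h b -> Gam (g * h)%g (a * b).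
Proof. by case: Gam => c ? ? cM /=; apply: cM. Qed.

Lemma fsbig_single (A : zmodType) (G : choiceType) (h : G) (a : A) :
  \sum_(g \in [set: G]) (if g == h then a else 0) = a.
Proof.
rewrite -(fsbig_widen [set h]) => [|//|g [_ /= /eqP/negPf ->] //].
by rewrite fsbig_set1 eqxx.
Qed.

(** If [a] had two degrees, it would have two homogeneous decompositions, each
    with [a] as its only nonzero term. *)
Lemma grading_degree_uniq (F : fieldType) (A : algType F) (G : groupType)
    (Gam : grading A G) (g h : G) (a : A) :
  Gam g a -> Gam h a -> a != 0 -> g = h.
Proof.
move=> ga ha a0.
pose c g' := fun g'' : G => if g'' == g' then a else 0.
have cP g' : Gam g' a -> [/\ finite_set [set g'' | c g' g'' != 0],
    forall g'', Gam g'' (c g' g'') & a = \sum_(g'' \in [set: G]) c g' g''].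
  move=> g'a; split; last by rewrite fsbig_single.
    apply: (@sub_finite_set _ _ [set g']) (finite_set1 g') => g'' /=.
    by rewrite /c; case: (g'' =P g') => // _; rewrite eqxx.
  by move=> g''; rewrite /c; case: eqP => [->//|_]; apply: grading0.
have [c0 [_ c0U]] : exists! c : G -> A, [/\ finite_set [set g | c g != 0],
    forall g, Gam g (c g) & a = \sum_(g \in [set: G]) c g].
  by case: Gam {ga ha cP}.
have /(congr1 (fun f => f g)) : c g = c h.
  by rewrite -(c0U _ (cP _ ga)) -(c0U _ (cP _ ha)).
by rewrite /c eqxx; case: eqP => // _ /eqP; rewrite (negPf a0).
Qed.

(** The product [a * b] has [H]-degree [psi g * psi h] because [Del] is a
    grading, and [psi (g * h)] because [psi] relabels the component of degree
    [g * h]; being nonzero, it has only one degree. *)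
Lemma realization_mul (F : fieldType) (A : algType F) (G H : groupType)
    (Gam : grading A G) (Del : grading A H) (psi : G -> H) (g h : G) (a b : A) :
  realization Gam Del psi -> Gam g a -> Gam h b -> a * b != 0 ->
  psi (g * h)%g = (psi g * psi h)%g.
Proof.
move=> [_ _ DG] ga hb ab0.
have a0 : a != 0 by apply: contraNneq ab0 => ->; rewrite mul0r.
have b0 : b != 0 by apply: contraNneq ab0 => ->; rewrite mulr0.
have gM : Gam (g * h)%g (a * b) by apply: grading_mul.
apply: (@grading_degree_uniq _ _ _ Del _ _ (a * b) _ _ ab0).
  by rewrite DG //; exists (a * b).
by apply: grading_mul; rewrite DG //; [exists a | exists b].
Qed.

Lemma realization_id (F : fieldType) (A : algType F) (G : groupType)
    (Gam : grading A G) : realization Gam Gam id.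
Proof. by split=> //; rewrite image_id. Qed.

(** * Elementary gradings *)

(** The span of the matrix units of degree [g], described by entries. *)
Definition elementary_component (F : fieldType) (G : groupType) (n : nat)
    (t : 'I_n.+1 -> G) (g : G) : set 'M[F]_n.+1 :=
  [set a | forall i j, a i j != 0 -> (t i * (t j)^-1)%g = g].

Arguments elementary_component F {G n} t g _.

Lemma elementary_componentN (F : fieldType) (G : groupType) (n : nat)
    (t : 'I_n.+1 -> G) (g : G) (a : 'M[F]_n.+1) (i j : 'I_n.+1) :
  elementary_component F t g a -> (t i * (t j)^-1)%g <> g -> a i j = 0.
Proof. by move=> ga tij; apply/eqP; apply: contra_notT tij; apply: ga. Qed.

(** Each entry position has one degree, so a sum over the components has a
    single contribution to it; this gives both the existence and the uniqueness
    of homogeneous decompositions. *)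
Lemma elementary_sum_entry (F : fieldType) (G : groupType) (n : nat)
    (t : 'I_n.+1 -> G) (c : G -> 'M[F]_n.+1) (i j : 'I_n.+1) :
  finite_set [set g | c g != 0] ->
  (forall g, elementary_component F t g (c g)) ->
  (\sum_(g \in [set: G]) c g) i j = c (t i * (t j)^-1)%g i j.
Proof.
move=> cfin cc; rewrite (fsbig_supp _ setT c) setTI.
have fin : finite_set (c @^-1` [set~ 0]).
  by apply: sub_finite_set cfin => g /= /eqP.
rewrite fsbig_finite // summxE -(fsbig_finite _ (fun g => c g i j)) //.
rewrite -[RHS](fsbig_single (t i * (t j)^-1)%g).
rewrite (fsbig_widen _ [set: G]) => [|//|g [_ /= /contrapT ->]]; last first.
  by rewrite mxE.
apply: eq_fsbigr => g _; case: eqP => [->//|/nesym tij].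
exact: elementary_componentN (cc g) tij.
Qed.

Lemma elementary_grading_exists (F : fieldType) (G : groupType) (n : nat)
    (t : 'I_n.+1 -> G) :
  exists Gam : grading 'M[F]_n.+1 G,
    forall g, Gam g = elementary_component F t g.
Proof.
have submod g : GRing.submod_closed (mem (elementary_component F t g)).
  split=> [|a u v /set_mem uG /set_mem vG]; apply/mem_set => i j.
    by rewrite mxE eqxx.
  rewrite !mxE => auv; apply: contrapT => tij; move: auv.
  rewrite (elementary_componentN uG tij).
  by rewrite (elementary_componentN vG tij) mulr0 addr0 eqxx.
have decomp (a : 'M[F]_n.+1) : exists! c : G -> 'M[F]_n.+1,
    [/\ finite_set [set g | c g != 0],
        forall g, elementary_component F t g (c g) &
        a = \sum_(g \in [set: G]) c g].
  pose c g := \matrix_(i, j) (if (t i * (t j)^-1)%g == g then a i j else 0).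
  have cc g : elementary_component F t g (c g).
    by move=> i j; rewrite mxE; case: (_ =P g) => // _; rewrite eqxx.
  have cfin : finite_set [set g | c g != 0].
    pose d (p : 'I_n.+1 * 'I_n.+1) := (t p.1 * (t p.2)^-1)%g.
    have dfin : finite_set (d @` setT).
      by apply: finite_image; apply: finite_finset.
    apply: sub_finite_set dfin => g /=; apply: contra_neqP => gd.
    apply/matrixP => i j.
    by rewrite !mxE; case: eqP => // tij; case: gd; exists (i, j).
  exists c; split=> [|c' [c'fin c'c a_c']].
    split=> //; apply/matrixP => i j.
    by rewrite (elementary_sum_entry (t := t)) // mxE eqxx.
  apply/funext => g; apply/matrixP => i j; rewrite mxE; case: eqP => [<-|tij].
    by rewrite a_c' (elementary_sum_entry (t := t)).
  by rewrite (elementary_componentN (c'c g) tij).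
have mult g h a b : elementary_component F t g a ->
    elementary_component F t h b ->
    elementary_component F t (g * h)%g (a * b).
  move=> ga hb i j; rewrite mxE; apply: contraPP => tij.
  rewrite big1 ?eqxx // => l _.
  have [|al0] := eqVneq (a i l) 0; first by move=> ->; rewrite mul0r.
  have [->|bl0] := eqVneq (b l j) 0; first by rewrite mulr0.
  case: tij; rewrite -(ga _ _ al0) -(hb _ _ bl0).
  by rewrite mulgA mulgVK.
by exists (Grading submod decomp mult).
Qed.

Lemma elementary_gradingP (F : fieldType) (G : groupType) (n : nat)
    (t : 'I_n.+1 -> G) (Gam : grading 'M[F]_n.+1 G) :
  (forall g, Gam g = elementary_component F t g) -> elementary t Gam.
Proof.
move=> GamE i j; rewrite GamE => i' j'; rewrite mxE.
by case: (i' =P i) => [->|_]; case: (j' =P j) => [->|_]; rewrite ?eqxx.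
Qed.

Lemma delta_mx_neq0 (F : fieldType) (m n : nat) (i : 'I_m) (j : 'I_n) :
  delta_mx i j != 0 :> 'M[F]_(m, n).
Proof.
by apply/eqP => /matrixP/(_ i j)/eqP; rewrite !mxE !eqxx oner_eq0.
Qed.

Lemma supp_elementary (F : fieldType) (G : groupType) (n : nat)
    (t : 'I_n.+1 -> G) (Gam : grading 'M[F]_n.+1 G) :
  (forall g, Gam g = elementary_component F t g) ->
  supp Gam = [set (t p.1 * (t p.2)^-1)%g | p in [set: 'I_n.+1 * 'I_n.+1]].
Proof.
move=> GamE; apply/seteqP; split=> g /=.
  case=> a; rewrite GamE => ga; apply: contra_neqP => gt.
  apply/matrixP => i j; rewrite mxE.
  by apply: elementary_componentN ga _ => tij; apply: gt; exists (i, j).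
case=> -[i j] _ <-; exists (delta_mx i j); last exact: delta_mx_neq0.
exact: elementary_gradingP.
Qed.

Lemma realization_elementary (F : fieldType) (G H : groupType) (n : nat)
    (t : 'I_n.+1 -> G) (Gam : grading 'M[F]_n.+1 G)
    (Del : grading 'M[F]_n.+1 H) (psi : G -> H) (i j l : 'I_n.+1) :
  elementary t Gam -> realization Gam Del psi ->
  (psi (t i * (t j)^-1) * psi (t j * (t l)^-1))%g = psi (t i * (t l)^-1)%g.
Proof.
move=> Gamt real; rewrite -(realization_mul real (Gamt i j) (Gamt j l)).
  by rewrite mulgA mulgVK.
by rewrite -[_ * _]/(_ *m _) mul_delta_mx delta_mx_neq0.
Qed.

End Gradings.

Theorem theorem4p3 (G : groupType) (k : nat) (x : 'I_k -> G) (R : seq (word k))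
    (hG : finite_presentation x R) (V : set G) (hV : finite_set V) :
  exists n : nat, forall F : fieldType,
    exists (t : 'I_n.+1 -> G) (Gam : grading 'M[F]_n.+1 G),
      [/\ elementary t Gam,
          exists (U : groupType) (kappa : G -> U),
            universal_group Gam kappa /\ isomorphic_groups U G &
          V `<=` supp Gam].
Proof.
have [s VE] := (finite_seqP V).1 hV.
have [c cK] := boolp.choice hG.1.
have [P [nilP subP pfxP]] := prefix_closed_superset
  (R ++ [seq [:: l] | l <- enum {: 'I_k * bool}] ++ [seq c v | v <- s]).
have RP : {subset R <= P} by move=> r rR; rewrite subP // mem_cat rR.
have letP l : [:: l] \in P.
  by rewrite subP // !mem_cat map_f ?orbT // mem_enum.
have VP v : V v -> c v \in P.
  by rewrite VE => vs; rewrite subP // !mem_cat (map_f c) ?orbT.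
(* [P] contains the empty word, so matrices of size [(size P).-1.+1] have one
   row for each word of [P]. *)
exists (size P).-1 => F.
have sizeP : (size P).-1.+1 = size P by case: (P) nilP.
pose t (i : 'I_(size P).-1.+1) := eval_word x (nth [::] P i).
have tP w : w \in P -> exists i, t i = eval_word x w.
  move=> wP; exists (inord (index w P)).
  by rewrite /t inordK ?nth_index // sizeP index_mem.
have Pt (i : 'I_(size P).-1.+1) : nth [::] P i \in P.
  by rewrite mem_nth // (leq_trans (ltn_ord i)) // sizeP.
have [Gam GamE] := elementary_grading_exists F t.
have Gamt := elementary_gradingP GamE.
have suppP u v : u \in P -> v \in P ->
    supp Gam (eval_word x u * (eval_word x v)^-1)%g.
  move=> /tP[i <-] /tP[j <-]; rewrite (supp_elementary GamE).
  by exists (i, j).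
have suppP1 u : u \in P -> supp Gam (eval_word x u).
  by move=> uP; have := suppP _ _ uP nilP; rewrite eval_word_nil invg1 mulg1.
exists t, Gam; split=> //; last by move=> v /VP/suppP1; rewrite cK.
exists G, id; split; last by exists idfun; exists id.
split; first by exists Gam; apply: realization_id.
move=> H Del psi real.
have [|phi phiM phiE] :=
    quotients_extend_morph (psi := psi) hG pfxP letP nilP RP.
  move=> _ _ _ /tP[i <-] /tP[j <-] /tP[l <-].
  exact: realization_elementary Gamt real.
exists phi; split=> [|phi' [phi'M phi'E]].
  split=> // g; rewrite (supp_elementary GamE) => -[[i j] _ <-].
  exact: phiE.
apply/funext; apply: (morph_generators_eq hG phiM phi'M) => i /=.
have -> : x i = eval_word x [:: (i, true)] by rewrite eval_word1.
rewrite (phi'E _ (suppP1 _ (letP _))).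
by have := phiE _ _ (letP (i, true)) nilP; rewrite eval_word_nil invg1 mulg1.
Qed.
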